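(* Suppose $T$ is a normal tree. Then: (1) if $T$ is absolutely rigid or totally rigid, then $T$ is rigid; (2) if $T$ is absolutely totally rigid, then it is totally rigid and absolutely rigid; (3) if $T$ has the UBP, then it is totally rigid; (4) if $T$ is absolutely UBP, then it has the UBP and is absolutely totally rigid.
   Context: A tree is a partial order with a unique minimal element in which the predecessors of every node are well ordered. For $\alpha\le\omega_1$, an $\alpha$-tree is a tree of height $\alpha$ with countable levels; it is normal if every node has at least two immediate successors (except those on the top level if $\alpha$ is a successor), nodes on limit levels are determined by their predecessors, and every node has successors on every higher level below $\alpha$. $T_p=\{q: q\ge_T p\}$. When forcing with a tree the order is reversed. $T$ is rigid if it has no nontrivial automorphism; totally rigid if $T_p\not\cong T_q$ for distinct nodes $p,q$; has the UBP if $1\Vdash_T$ ''$T$ has exactly one new cofinal branch''; absolutely rigid / absolutely totally rigid / absolutely UBP if $1\Vdash_T$ ''$T$ is rigid / totally rigid / has the UBP'', respectively. *)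

(* Defs.v *)
From Stdlib Require Import Relation_Definitions.

Set Implicit Arguments.
Unset Strict Implicit.

(** * Trees *)

Definition well_ordered_on (A : Type) (le : A -> A -> Prop) (D : A -> Prop) :=
  forall S : A -> Prop, (forall x, S x -> D x) -> (exists x, S x) ->
  exists m, S m /\ forall x, S x -> le m x.

Definition countable_set (A : Type) (D : A -> Prop) :=
  exists f : A -> nat, forall x y, D x -> D y -> f x = f y -> x = y.

Definition minimal (A : Type) (le : A -> A -> Prop) (m : A) :=
  forall x, le x m -> x = m.

Record tree := Tree {
  node :> Type;
  tle : node -> node -> Prop;
  root : node;
  tle_order : order node tle;
  root_minimal : minimal tle root;
  root_unique : forall m, minimal tle m -> m = root;
  predecessors_wo :
    forall t, well_ordered_on tle (fun s => tle s t /\ s <> t)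
}.

Arguments tle {t} _ _ : rename.
Arguments root {t} : rename.

Definition tlt (T : tree) (s t : T) := tle s t /\ s <> t.

Definition cone (T : tree) (p : T) : T -> Prop := fun q => tle p q.

Definition immediate_successor (T : tree) (t s : T) :=
  tlt t s /\ ~ exists u, tlt t u /\ tlt u s.

(** An ordinal is given by a well-ordered type of that order type, whose
    elements stand for the smaller ordinals. *)
Record ordinal := Ordinal {
  below :> Type;
  ole : below -> below -> Prop;
  ole_order : order below ole;
  ole_wo : well_ordered_on ole (fun _ => True)
}.

Arguments ole {o} _ _ : rename.

Definition olt (alpha : ordinal) (b c : alpha) := ole b c /\ b <> c.

(** [alpha <= omega_1]: every ordinal below [alpha] is countable. *)
Definition le_omega1 (alpha : ordinal) :=
  forall b : alpha, countable_set (fun c => olt c b).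

(** [b + 1 = alpha]. *)
Definition is_top (alpha : ordinal) (b : alpha) := forall c, ole c b.

Definition is_limit (alpha : ordinal) (b : alpha) :=
  (exists c, olt c b) /\ forall c, olt c b -> exists d, olt c d /\ olt d b.

(** [level t] is the order type of the predecessors of [t]: by the first two
    axioms on [level] it restricts to an isomorphism from [{s | s < t}] onto
    [{b | b < level t}], which determines it. *)
Record alpha_tree (alpha : ordinal) := AlphaTree {
  tree_of :> tree;
  level : tree_of -> alpha;
  level_lt : forall s t, tlt s t -> olt (level s) (level t);
  level_onto : forall t b, olt b (level t) -> exists s, tlt s t /\ level s = b;
  level_inhabited : forall b, exists t, level t = b;
  level_countable : forall b, countable_set (fun t => level t = b)
}.

Arguments level {alpha a} _ : rename.

Record normal (alpha : ordinal) (T : alpha_tree alpha) : Prop := Normal {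
  normal_splitting : forall t : T, ~ is_top (level t) ->
    exists s1 s2, s1 <> s2 /\
      immediate_successor t s1 /\ immediate_successor t s2;
  normal_limit : forall s t : T, is_limit (level s) -> is_limit (level t) ->
    (forall u, tlt u s <-> tlt u t) -> s = t;
  normal_extension : forall (t : T) (b : alpha), olt (level t) b ->
    exists s, tlt t s /\ level s = b
}.

(** * Universes and forcing *)

(** A universe of sets, as far as statements about subsets of, and relations
    on, sets of the ground model are concerned.  [form] is the type of the
    statements about the universe.  An element of [bit] names a subset (in the
    universe) of a one-point set, so that [A -> bit] is the type of (names of)
    the subsets of [A] that the universe contains, and [A -> B -> bit] that of
    the relations; [is_in (X a)] is the statement "[a] is in [X]".  [fground P]
    is a fact [P] about elements of the ground model. *)
Record universe := Universe {
  form : Type;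
  bit : Type;
  is_in : bit -> form;
  fground : Prop -> form;
  fand : form -> form -> form;
  fimp : form -> form -> form;
  fall : forall A : Type, (A -> form) -> form;
  fex : forall A : Type, (A -> form) -> form
}.

Arguments is_in {u} _ : rename.
Arguments fground {u} _ : rename.
Arguments fand {u} _ _ : rename.
Arguments fimp {u} _ _ : rename.
Arguments fall {u} A _ : rename.
Arguments fex {u} A _ : rename.

Declare Scope form_scope.
Delimit Scope form_scope with form.
Bind Scope form_scope with form.

Notation "[[ P ]]" := (fground P%type) (at level 0, P at level 200) : form_scope.
Notation "phi &&& psi" := (fand phi psi)
  (at level 80, right associativity) : form_scope.
Notation "phi ==> psi" := (fimp phi psi)
  (at level 90, right associativity) : form_scope.
Notation "!! phi" := (fimp phi (fground False))
  (at level 75, right associativity) : form_scope.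
Notation "'ALL' x : A , phi" := (fall A%type (fun x => phi))
  (at level 200, x name, A at level 200) : form_scope.
Notation "'EX' x : A , phi" := (fex A%type (fun x => phi))
  (at level 200, x name, A at level 200) : form_scope.

Local Open Scope form_scope.

Definition fiff (M : universe) (phi psi : form M) : form M :=
  (phi ==> psi) &&& (psi ==> phi).

(** The ground model. *)
Definition V : universe :=
  @Universe Prop Prop
    (fun b => b) (fun P => P) and (fun P Q => P -> Q)
    (fun A P => forall x : A, P x) (fun A P => exists x : A, P x).

Section Forcing.

Variables (T : tree) (M : universe).

(** "For all (some) conditions [q] stronger than [p]": forcing with a tree
    reverses its order. *)
Definition all_stronger (p : T) (phi : T -> form M) : form M :=
  ALL q : T, [[ tle p q ]] ==> phi q.
Definition some_stronger (p : T) (phi : T -> form M) : form M :=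
  EX q : T, [[ tle p q ]] &&& phi q.

(** The extension of [M] by forcing with [T].  A statement [phi] about it is
    given by the statements "[p] forces [phi]", for [p] in [T], about [M].  A
    name of a subset of [A] is a subset, in [M], of [A * T]: the pair [(a, s)]
    puts [a] into the subset as soon as [s] is in the generic filter.  So [p]
    forces that [a] is in the subset when, densely below [p], there are
    conditions [r] stronger than some [s] such that [(a, s)] is in the name.
    The other clauses are the usual ones. *)
Definition extension : universe :=
  @Universe (T -> form M) (T -> bit M)
    (fun u p => all_stronger p (fun q => some_stronger q (fun r =>
       EX s : T, [[ tle s r ]] &&& is_in (u s))))
    (fun P p => [[ P ]])
    (fun phi psi p => phi p &&& psi p)
    (fun phi psi p => all_stronger p (fun q => phi q ==> psi q))
    (fun A phi p => ALL x : A, phi x p)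
    (fun A phi p => all_stronger p (fun q => some_stronger q (fun r =>
       EX x : A, phi x r))).

(** The canonical name, in [extension], of a subset of [A] in [M]. *)
Definition check (A : Type) (X : A -> bit M) : A -> bit extension :=
  fun a _ => X a.

(** "1 forces [phi]"; the weakest condition is the root of [T]. *)
Definition forced (phi : form extension) : form M := phi root.

End Forcing.

Arguments check T {M A} X.

(** * Rigidity notions, as statements about a universe *)

Section InUniverse.

Variable M : universe.

(** [R] is the graph of an isomorphism from the suborder [D] of [T] onto the
    suborder [E]. *)
Definition isomorphism (T : tree) (D E : T -> Prop) (R : T -> T -> bit M) :
    form M :=
  (ALL x : T, ALL y : T, is_in (R x y) ==> [[ D x /\ E y ]]) &&&
  (ALL x : T, [[ D x ]] ==> EX y : T, is_in (R x y)) &&&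
  (ALL y : T, [[ E y ]] ==> EX x : T, is_in (R x y)) &&&
  (ALL x : T, ALL y : T, ALL y' : T,
     is_in (R x y) ==> is_in (R x y') ==> [[ y = y' ]]) &&&
  (ALL x : T, ALL x' : T, ALL y : T,
     is_in (R x y) ==> is_in (R x' y) ==> [[ x = x' ]]) &&&
  (ALL x : T, ALL y : T, ALL x' : T, ALL y' : T,
     is_in (R x y) ==> is_in (R x' y') ==> [[ tle x x' <-> tle y y' ]]).

Definition automorphism (T : tree) (R : T -> T -> bit M) : form M :=
  isomorphism (fun _ => True) (fun _ => True) R.

Definition nontrivial (T : tree) (R : T -> T -> bit M) : form M :=
  EX x : T, EX y : T, is_in (R x y) &&& [[ x <> y ]].

Definition rigid (T : tree) : form M :=
  !! (EX R : T -> T -> bit M, automorphism R &&& nontrivial R).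

Definition totally_rigid (T : tree) : form M :=
  ALL p : T, ALL q : T, [[ p <> q ]] ==>
    !! (EX R : T -> T -> bit M, isomorphism (cone p) (cone q) R).

(** A branch is a maximal chain; it is cofinal if it meets every level. *)
Definition cofinal_branch (alpha : ordinal) (T : alpha_tree alpha)
    (B : T -> bit M) : form M :=
  (ALL s : T, ALL t : T, is_in (B s) ==> is_in (B t) ==>
     [[ tle s t \/ tle t s ]]) &&&
  (ALL t : T, (ALL s : T, is_in (B s) ==> [[ tle s t \/ tle t s ]]) ==>
     is_in (B t)) &&&
  (ALL b : alpha, EX t : T, is_in (B t) &&& [[ level t = b ]]).

Definition same_set (A : Type) (X Y : A -> bit M) : form M :=
  ALL a : A, fiff (is_in (X a)) (is_in (Y a)).

End InUniverse.

Arguments rigid M T : clear implicits.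
Arguments totally_rigid M T : clear implicits.

Section Absolute.

Variables (M : universe) (alpha : ordinal) (T : alpha_tree alpha).

(** New in the extension of [M] by [T], that is, not in [M]. *)
Definition new_cofinal_branch (B : T -> bit (extension T M)) :
    form (extension T M) :=
  cofinal_branch B &&& ALL X : T -> bit M, !! same_set B (check T X).

Definition exactly_one_new_cofinal_branch : form (extension T M) :=
  EX B : T -> bit (extension T M), new_cofinal_branch B &&&
    ALL C : T -> bit (extension T M), new_cofinal_branch C ==> same_set C B.

Definition UBP : form M := forced exactly_one_new_cofinal_branch.

End Absolute.

Arguments UBP M {alpha} T.

Definition absolutely_rigid (T : tree) : form V :=
  forced (rigid (extension T V) T).

Definition absolutely_totally_rigid (T : tree) : form V :=
  forced (totally_rigid (extension T V) T).

Definition absolutely_UBP (alpha : ordinal) (T : alpha_tree alpha) : form V :=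
  forced (UBP (extension T V) T).

(* Main.v *)
(** Each universe is read as a forcing semantics: a preorder of conditions and a
    relation [holds] under which the names of subsets of a point are the regular
    predicates on conditions.  The ground model has one condition, and the
    extension of [M] by [T] has as conditions the pairs of one of [T] and one of
    [M]; an argument made for all such semantics thus holds in both universes.

    Isomorphisms of the ground model remain isomorphisms in the extension, and
    an automorphism moving [x] to [y] restricts to an isomorphism of cones.  If
    [T] has the UBP and [R] maps the cone of [p] onto that of [q], the image
    under [R] of the generic branch through [p] is a new cofinal branch through
    [q], so it is the generic branch; hence [p] forces [q] into the generic
    branch, so that [q <= p], and [p = q] by symmetry.  If [T] is absolutely UBP
    and [C] names a new cofinal branch, evaluate [C] with the second of two
    mutually generic branches: the result is not in the extension by the first,
    so it coincides with the second generic branch. *)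

From Stdlib Require Setoid.
From Stdlib Require Import Classical.
Require Import Defs.

Set Implicit Arguments.
Unset Strict Implicit.

(** * Forcing semantics and regular predicates on conditions *)

Definition densely (W : Type) (le : W -> W -> Prop) (P : W -> Prop) (w : W) :=
  forall v, le w v -> exists u, le v u /\ P u.

(** Larger worlds are stronger conditions. These predicates are the regular open sets, that is, the
    values of the Boolean completion. *)
Definition regular (W : Type) (le : W -> W -> Prop) (P : W -> Prop) :=
  (forall w v, le w v -> P w -> P v) /\ (forall w, densely le P w -> P w).

(** [holds_ex] is restricted to regular [phi] because forms are arbitrary: in an extension the inner
    existential can be evaluated only when the sections of [phi] are regular over [M]. [bit_of] is
    comprehension, giving a name to every regular predicate. *)
Record model (M : universe) := Model {
  world : Type;
  wle : world -> world -> Prop;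
  wle_refl : forall w, wle w w;
  wle_trans : forall u v w, wle u v -> wle v w -> wle u w;
  holds : form M -> world -> Prop;
  holds_ground : forall P w, holds (fground P) w <-> P;
  holds_and : forall phi psi w,
    holds (fand phi psi) w <-> holds phi w /\ holds psi w;
  holds_imp : forall phi psi w,
    holds (fimp phi psi) w <->
    forall v, wle w v -> holds phi v -> holds psi v;
  holds_all : forall (A : Type) (phi : A -> form M) w,
    holds (fall A phi) w <-> forall x, holds (phi x) w;
  holds_ex : forall (A : Type) (phi : A -> form M) w,
    (forall x, regular wle (holds (phi x))) ->
    (holds (fex A phi) w <->
     densely wle (fun u => exists x, holds (phi x) u) w);
  regular_is_in : forall b, regular wle (holds (is_in b));
  bit_of : (world -> Prop) -> bit M;
  holds_bit_of : forall P w, regular wle P ->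
    (holds (is_in (bit_of P)) w <-> P w)
}.

Arguments wle {M m} _ _ : rename.
Arguments holds {M m} _ _ : rename.

Lemma densely_regular (W : Type) (le : W -> W -> Prop) (P : W -> Prop) :
  (forall w, le w w) -> (forall u v w, le u v -> le v w -> le u w) ->
  regular le (densely le P).
Proof.
  intros Hr Ht; split.
  - intros w v Hwv H u Hu. apply H; eauto.
  - intros w H v Hv. destruct (H v Hv) as (u & Hu & Hd).
    destruct (Hd u (Hr u)) as (u' & Hu' & HP); eauto.
Qed.

Section Model.

Context (M : universe) (K : model M).

Notation regular_form phi := (regular (wle (m := K)) (holds (m := K) phi)).

Lemma regular_ground (P : Prop) : regular_form (fground P).
Proof.
  split.
  - intros w v _. now rewrite !holds_ground.
  - intros w H. destruct (H w (wle_refl w)) as (u & _ & Hu).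
    now rewrite holds_ground in *.
Qed.

Lemma regular_and (phi psi : form M) :
  regular_form phi -> regular_form psi -> regular_form (fand phi psi).
Proof.
  intros [m1 d1] [m2 d2]; split.
  - intros w v Hwv. rewrite !holds_and. intros []; eauto.
  - intros w H. rewrite holds_and. split; [apply d1 | apply d2];
      intros v Hv; destruct (H v Hv) as (u & Hu & Hh);
      rewrite holds_and in Hh; destruct Hh; eauto.
Qed.

Lemma regular_imp (phi psi : form M) :
  regular_form phi -> regular_form psi -> regular_form (fimp phi psi).
Proof.
  intros [m1 _] [_ d2]; split.
  - intros w v Hwv. rewrite !holds_imp. intros H u Hu.
    apply H; eapply wle_trans; eauto.
  - intros w H. rewrite holds_imp. intros v Hv Hp. apply d2. intros u Hu.
    destruct (H u (wle_trans Hv Hu)) as (u' & Hu' & Hh).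
    rewrite holds_imp in Hh. exists u'. split; [assumption|].
    apply Hh; [apply wle_refl|]. apply m1 with v; [eapply wle_trans|]; eauto.
Qed.

Lemma regular_all (A : Type) (phi : A -> form M) :
  (forall x, regular_form (phi x)) -> regular_form (fall A phi).
Proof.
  intros Hphi; split.
  - intros w v Hwv. rewrite !holds_all. intros H x.
    apply (proj1 (Hphi x)) with w; auto.
  - intros w H. rewrite holds_all. intros x. apply (proj2 (Hphi x)).
    intros v Hv. destruct (H v Hv) as (u & Hu & Hh). rewrite holds_all in Hh.
    eauto.
Qed.

Lemma regular_ex (A : Type) (phi : A -> form M) :
  (forall x, regular_form (phi x)) -> regular_form (fex A phi).
Proof.
  intros Hphi.
  destruct (densely_regular (fun u => exists x, holds (phi x) u)
    (@wle_refl _ K) (@wle_trans _ K)) as [m d].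
  split.
  - intros w v Hwv. rewrite !holds_ex by assumption. eauto.
  - intros w H. rewrite holds_ex by assumption. apply d. intros v Hv.
    destruct (H v Hv) as (u & Hu & Hh). rewrite holds_ex in Hh by assumption.
    eauto.
Qed.

End Model.

Create HintDb regular.
#[local] Hint Resolve regular_ground regular_and regular_imp regular_all
  regular_ex regular_is_in : regular.

Lemma monotone (M : universe) (K : model M) (phi : form M) (w v : world K) :
  regular (wle (m := K)) (holds phi) -> wle w v -> holds phi w -> holds phi v.
Proof. intros [m _]. apply m. Qed.

Lemma mem_monotone (M : universe) (K : model M) (b : bit M) (w v : world K) :
  wle w v -> holds (is_in b) w -> holds (is_in b) v.
Proof. apply monotone, regular_is_in. Qed.

(* The ground model as a semantics with one condition *)
#[local] Obligation Tactic := idtac.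

Program Definition V_model : model V :=
  @Model V unit (fun _ _ => True) _ _ (fun phi _ => phi) _ _ _ _ _ _
    (fun P => P tt) _.
Next Obligation. exact (fun _ => I). Qed.
Next Obligation. exact (fun _ _ _ _ _ => I). Qed.
Next Obligation. reflexivity. Qed.
Next Obligation. reflexivity. Qed.
Next Obligation. intros phi psi []. split; [auto | intros H; exact (H tt I)]. Qed.
Next Obligation. reflexivity. Qed.
Next Obligation.
  intros A phi w _. split.
  - intros H v _. exists tt. auto.
  - intros H. destruct (H tt I) as ([] & _ & Hx). exact Hx.
Qed.
Next Obligation.
  split; [auto|]. intros w H. destruct (H tt I) as (_ & _ & Hx). exact Hx.
Qed.
Next Obligation. intros P [] _. reflexivity. Qed.

(** * The extension as a semantics on pairs of conditions *)

Section ExtensionModel.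

Context (T : tree) (M : universe) (K : model M).

Definition ext_le (x y : T * world K) :=
  tle (fst x) (fst y) /\ wle (snd x) (snd y).

Definition ext_holds (phi : form (extension T M)) (x : T * world K) :=
  holds (m := K) (phi (fst x)) (snd x).

Lemma tle_refl (t : T) : tle t t.
Proof. apply (tle_order T). Qed.

Lemma tle_trans (s t u : T) : tle s t -> tle t u -> tle s u.
Proof. apply (tle_order T). Qed.

Lemma tle_antisym (s t : T) : tle s t -> tle t s -> s = t.
Proof. apply (tle_order T). Qed.

Lemma ext_le_refl x : ext_le x x.
Proof. split; [apply tle_refl | apply wle_refl]. Qed.

Lemma ext_le_trans x y z : ext_le x y -> ext_le y z -> ext_le x z.
Proof.
  intros [H1 H2] [H3 H4]; split; [eapply tle_trans | eapply wle_trans]; eauto.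
Qed.

Lemma holds_all_stronger (p : T) (phi : T -> form M) (w : world K) :
  holds (all_stronger p phi) w <->
  forall q v, ext_le (p, w) (q, v) -> holds (phi q) v.
Proof.
  unfold all_stronger. rewrite holds_all. split.
  - intros H q v [Hq Hv]. specialize (H q). rewrite holds_imp in H.
    apply H; [assumption|]. now rewrite holds_ground.
  - intros H q. rewrite holds_imp. intros v Hv. rewrite holds_ground.
    intros Hq. apply H. now split.
Qed.

Lemma holds_some_stronger (p : T) (phi : T -> form M) (w : world K) :
  (forall q, regular (wle (m := K)) (holds (phi q))) ->
  (holds (some_stronger p phi) w <->
   densely wle (fun u => exists q, tle p q /\ holds (phi q) u) w).
Proof.
  intros Hphi. unfold some_stronger. rewrite holds_ex by auto with regular.
  split; intros H v Hv; destruct (H v Hv) as (u & Hu & q & Hq);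
    exists u; split; trivial; exists q.
  - rewrite holds_and, holds_ground in Hq. exact Hq.
  - rewrite holds_and, holds_ground. exact Hq.
Qed.

(** Over [M] the stronger tree condition is itself found only densely in [K]; both searches merge
    into one in the product order. *)
Lemma holds_dense (p : T) (phi : T -> form M) (w : world K) :
  (forall q, regular (wle (m := K)) (holds (phi q))) ->
  (holds (all_stronger p (fun q => some_stronger q phi)) w <->
   densely ext_le (fun x => holds (phi (fst x)) (snd x)) (p, w)).
Proof.
  intros Hphi. rewrite holds_all_stronger. split.
  - intros H [q v] Hqv. specialize (H q v Hqv).
    rewrite holds_some_stronger in H by assumption.
    destruct (H v (wle_refl v)) as (u & Hu & r & Hr & Hh).
    exists (r, u). repeat split; assumption.
  - intros H q v Hqv. rewrite holds_some_stronger by assumption.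
    intros v' Hv'.
    destruct (H (q, v')) as ([r u] & [Hr Hu] & Hh).
    + apply ext_le_trans with (1 := Hqv). split; [apply tle_refl | assumption].
    + exists u. split; [exact Hu|]. exists r. split; assumption.
Qed.

(** A set dense over a fixed [p] becomes dense below [(p, w)] because monotonicity allows the tree
    coordinate to be raised afterwards. *)
Lemma regular_section (phi : form (extension T M)) (p : T) :
  regular ext_le (ext_holds phi) -> regular (wle (m := K)) (holds (phi p)).
Proof.
  intros [m d]. split.
  - intros w v Hwv. apply (m (p, w) (p, v)).
    split; [apply tle_refl | assumption].
  - intros w H. apply (d (p, w)). intros [q v] [Hq Hv].
    destruct (H v Hv) as (u & Hu & Hh). exists (q, u). split.
    + split; [apply tle_refl | assumption].
    + apply (m (p, u)); [|assumption]. split; [exact Hq | apply wle_refl].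
Qed.

Lemma ext_holds_is_in (b : bit (extension T M)) (x : T * world K) :
  ext_holds (is_in b) x <->
  densely ext_le
    (fun y => exists s, tle s (fst y) /\ holds (is_in (b s)) (snd y)) x.
Proof.
  destruct x as [p w]. unfold ext_holds; simpl.
  assert (reg : forall q s : T,
    regular (wle (m := K)) (holds (fand (fground (tle s q)) (is_in (b s)))))
    by auto with regular.
  rewrite holds_dense by auto with regular.
  split; intros H y Hy.
  - destruct (H y Hy) as (z & Hz & Hh). rewrite holds_ex in Hh by auto.
    destruct (Hh _ (wle_refl _)) as (u & Hu & s & Hs).
    rewrite holds_and, holds_ground in Hs.
    exists (fst z, u). split; [|exists s; exact Hs].
    apply ext_le_trans with (1 := Hz). split; [apply tle_refl | exact Hu].
  - destruct (H y Hy) as (z & Hz & s & Hs & Hh).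
    exists z. split; [assumption|]. rewrite holds_ex by auto. intros v Hv.
    exists v. split; [apply wle_refl|]. exists s.
    rewrite holds_and, holds_ground. split; [assumption|].
    eapply mem_monotone; eauto.
Qed.

(** The name chosen for a regular [P] carries the tag [s] exactly where [P (s, _)] holds;
    monotonicity and density of [P] make its evaluation return [P]. *)
Program Definition extension_model : model (extension T M) :=
  @Model (extension T M) (T * world K) ext_le ext_le_refl ext_le_trans ext_holds
    _ _ _ _ _ _ (fun P s => bit_of (fun w => P (s, w))) _.
Next Obligation. intros. apply holds_ground. Qed.
Next Obligation. intros. apply holds_and. Qed.
Next Obligation.
  intros phi psi [p w].
  unfold ext_holds at 1; simpl. rewrite holds_all_stronger. split.
  - intros H [q v] Hqv. specialize (H q v Hqv). rewrite holds_imp in H.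
    apply H, wle_refl.
  - intros H q v Hqv. rewrite holds_imp. intros u Hu. apply (H (q, u)).
    apply ext_le_trans with (1 := Hqv). split; [apply tle_refl | exact Hu].
Qed.
Next Obligation. intros. apply holds_all. Qed.
Next Obligation.
  intros A phi [p w] Hphi.
  assert (reg : forall (q : T) x, regular (wle (m := K)) (holds (phi x q)))
    by (intros; apply regular_section; auto).
  unfold ext_holds; simpl. rewrite holds_dense by auto with regular.
  split; intros H y Hy; destruct (H y Hy) as (z & Hz & Hh).
  - rewrite holds_ex in Hh by auto.
    destruct (Hh _ (wle_refl _)) as (u & Hu & Hx).
    exists (fst z, u). split; [|exact Hx].
    apply ext_le_trans with (1 := Hz). split; [apply tle_refl | exact Hu].
  - exists z. split; [assumption|]. destruct Hh as [x Hx].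
    rewrite holds_ex by auto. intros v Hv.
    exists v. split; [apply wle_refl|]. exists x. eapply monotone; eauto.
Qed.
Next Obligation.
  intros b.
  pose proof (densely_regular
    (fun y => exists s, tle s (fst y) /\ holds (is_in (b s)) (snd y))
    ext_le_refl ext_le_trans) as [m d].
  split.
  - intros w v Hwv. rewrite !ext_holds_is_in. eauto.
  - intros w H. rewrite ext_holds_is_in. apply d. intros v Hv.
    destruct (H v Hv) as (u & Hu & Hh). rewrite ext_holds_is_in in Hh. eauto.
Qed.
Next Obligation.
  intros P [p w] HP. rewrite ext_holds_is_in.
  assert (reg : forall s : T, regular (wle (m := K)) (fun w => P (s, w))).
  { intros s. destruct HP as [m d]. split.
    - intros v v' Hv. apply m. split; [apply tle_refl | exact Hv].
    - intros v H. apply d. intros [q v'] [Hq Hv].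
      destruct (H v' Hv) as (u & Hu & Hh). exists (q, u). split.
      + split; [apply tle_refl | assumption].
      + apply (m (s, u)); [|assumption]. split; [exact Hq | apply wle_refl]. }
  destruct HP as [m d]. split.
  - intros H. apply d. intros y Hy. destruct (H y Hy) as ([q v] & Hz & s & Hs & Hh).
    rewrite holds_bit_of in Hh by apply reg.
    exists (q, v). split; [assumption|].
    apply (m (s, v)); [|assumption]. split; [exact Hs | apply wle_refl].
  - intros H [q v] Hy. exists (q, v). split; [apply ext_le_refl|].
    exists q. split; [apply tle_refl|]. rewrite holds_bit_of by apply reg.
    now apply (m (p, w)).
Qed.

End ExtensionModel.

(** A canonical name is constant in its tag, so only the coordinate of [M] matters. All later
    arguments about ground model sets rest on this independence of the tree coordinate. *)
Lemma holds_check (T : tree) (M : universe) (K : model M) (A : Type)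
    (X : A -> bit M) (a : A) (x : world (extension_model T K)) :
  holds (m := extension_model T K) (is_in (check T X a)) x <->
  holds (m := K) (is_in (X a)) (snd x).
Proof.
  refine (iff_trans (ext_holds_is_in (K := K) _ _) _). split.
  - intros H. apply (proj2 (regular_is_in K (X a))). intros v Hv.
    destruct (H (fst x, v)) as (y & [_ Hy] & s & _ & Hs).
    + split; [apply tle_refl | exact Hv].
    + exists (snd y). split; assumption.
  - intros H y [_ Hy]. exists y. split; [apply ext_le_refl|].
    exists (fst y). split; [apply tle_refl|]. eapply mem_monotone; eauto.
Qed.

(** * Forced statements *)

Section Forced.

Context (M : universe) (K : model M).

Lemma holds_all_dense (A B : Type) (D : A -> Prop) (phi : A -> B -> form M)
    (w : world K) :
  (forall x y, regular (wle (m := K)) (holds (phi x y))) ->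
  (holds (fall A (fun x => fimp (fground (D x)) (fex B (phi x)))) w <->
   forall x, D x -> densely wle (fun u => exists y, holds (phi x y) u) w).
Proof.
  intros Hphi. rewrite holds_all. split; intros H x.
  - intros Hx. rewrite <- holds_ex by auto. specialize (H x).
    rewrite holds_imp in H. apply H; [apply wle_refl|]. now rewrite holds_ground.
  - rewrite holds_imp. intros v Hv. rewrite holds_ground. intros Hx.
    rewrite holds_ex by auto. intros u Hu. apply (H x Hx).
    eapply wle_trans; eauto.
Qed.

Lemma holds_mem_imp (b : bit M) (P : Prop) (w : world K) :
  holds (fimp (is_in b) (fground P)) w <->
  forall v, wle w v -> holds (is_in b) v -> P.
Proof.
  rewrite holds_imp. split; intros H v Hv Hb.
  - specialize (H v Hv Hb). now rewrite holds_ground in H.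
  - rewrite holds_ground. eauto.
Qed.

Lemma holds_mem_imp2 (b c : bit M) (P : Prop) (w : world K) :
  holds (fimp (is_in b) (fimp (is_in c) (fground P))) w <->
  forall v, wle w v -> holds (is_in b) v -> holds (is_in c) v -> P.
Proof.
  rewrite holds_imp. split.
  - intros H v Hv Hb Hc. specialize (H v Hv Hb). rewrite holds_mem_imp in H.
    apply (H v); [apply wle_refl | exact Hc].
  - intros H v Hv Hb. rewrite holds_mem_imp. intros u Hu Hc. apply (H u); trivial.
    + eapply wle_trans; eauto.
    + eapply mem_monotone; eauto.
Qed.

Lemma holds_not (phi : form M) (w : world K) :
  holds (fimp phi (fground False)) w <-> forall v, wle w v -> ~ holds phi v.
Proof.
  rewrite holds_imp. split; intros H v Hv Hp; specialize (H v Hv Hp);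
    now rewrite holds_ground in *.
Qed.

(** Totality and surjectivity become density conditions, since a value of [R] may be decided only by
    a stronger condition; the other clauses concern pairs that are already decided. *)
Record iso_at (T : tree) (D E : T -> Prop) (R : T -> T -> bit M)
    (w : world K) : Prop := IsoAt {
  iso_dom : forall x y v, wle w v -> holds (is_in (R x y)) v -> D x /\ E y;
  iso_total : forall x, D x ->
    densely wle (fun u => exists y, holds (is_in (R x y)) u) w;
  iso_onto : forall y, E y ->
    densely wle (fun u => exists x, holds (is_in (R x y)) u) w;
  iso_fun : forall x y y' v, wle w v ->
    holds (is_in (R x y)) v -> holds (is_in (R x y')) v -> y = y';
  iso_inj : forall x x' y v, wle w v ->
    holds (is_in (R x y)) v -> holds (is_in (R x' y)) v -> x = x';
  iso_mono : forall x y x' y' v, wle w v ->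
    holds (is_in (R x y)) v -> holds (is_in (R x' y')) v ->
    (tle x x' <-> tle y y')
}.

Lemma holds_isomorphism (T : tree) (D E : T -> Prop) (R : T -> T -> bit M)
    (w : world K) :
  holds (isomorphism D E R) w <-> iso_at D E R w.
Proof.
  unfold isomorphism. rewrite !holds_and, !holds_all_dense by auto with regular.
  repeat setoid_rewrite holds_all.
  setoid_rewrite holds_mem_imp2. setoid_rewrite holds_mem_imp.
  split.
  - intros (H1 & H2 & H3 & H4 & H5 & H6). constructor; eauto.
  - intros []. do 5 (split; [eauto|]). eauto.
Qed.

Lemma regular_isomorphism (T : tree) (D E : T -> Prop) (R : T -> T -> bit M) :
  regular (wle (m := K)) (holds (isomorphism D E R)).
Proof. unfold isomorphism. auto 12 with regular. Qed.

Lemma iso_at_monotone (T : tree) (D E : T -> Prop) (R : T -> T -> bit M)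
    (w v : world K) :
  wle w v -> iso_at D E R w -> iso_at D E R v.
Proof.
  rewrite <- !holds_isomorphism. apply monotone, regular_isomorphism.
Qed.

Lemma iso_at_inverse (T : tree) (D E : T -> Prop) (R : T -> T -> bit M)
    (w : world K) :
  iso_at D E R w -> iso_at E D (fun x y => R y x) w.
Proof.
  intros [H1 H2 H3 H4 H5 H6]. constructor; eauto.
  - intros x y v Hv H. apply and_comm. eauto.
  - intros x y x' y' v Hv H H'. apply iff_sym. eauto.
Qed.

(** The density hidden in the existential is absorbed by the negation: a stronger condition provides
    an actual name [R], and isomorphisms persist upwards. *)
Lemma holds_no_isomorphism (T : tree) (D E : T -> Prop) (w : world K) :
  holds (fimp (fex (T -> T -> bit M) (isomorphism D E)) (fground False)) w <->
  forall R v, wle w v -> ~ iso_at D E R v.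
Proof.
  rewrite holds_not. split.
  - intros H R v Hv HR. apply (H v Hv).
    rewrite holds_ex by (intros; apply regular_isomorphism).
    intros u Hu. exists u. split; [apply wle_refl|]. exists R.
    rewrite holds_isomorphism. eapply iso_at_monotone; eauto.
  - intros H v Hv HE. rewrite holds_ex in HE by (intros; apply regular_isomorphism).
    destruct (HE v (wle_refl v)) as (u & Hu & R & HR).
    rewrite holds_isomorphism in HR. apply (H R u); trivial.
    eapply wle_trans; eauto.
Qed.

Lemma holds_totally_rigid (T : tree) (w : world K) :
  holds (totally_rigid M T) w <->
  forall (p q : T) R v, p <> q -> wle w v -> ~ iso_at (cone p) (cone q) R v.
Proof.
  unfold totally_rigid. repeat setoid_rewrite holds_all.
  split.
  - intros H p q R v Hpq Hv. specialize (H p q). rewrite holds_imp in H.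
    specialize (H w (wle_refl w)). rewrite holds_ground in H.
    specialize (H Hpq). rewrite holds_no_isomorphism in H. auto.
  - intros H p q. rewrite holds_imp. intros v Hv. rewrite holds_ground.
    intros Hpq. rewrite holds_no_isomorphism. intros R u Hu.
    apply H; [assumption|]. eapply wle_trans; eauto.
Qed.

Lemma holds_rigid (T : tree) (w : world K) :
  holds (rigid M T) w <->
  forall R v, wle w v ->
    iso_at (fun _ : T => True) (fun _ : T => True) R v ->
    forall x y, holds (is_in (R x y)) v -> x = y.
Proof.
  assert (reg : forall R : T -> T -> bit M, regular (wle (m := K))
    (holds (fand (automorphism R) (nontrivial R)))).
  { intros R. apply regular_and; [apply regular_isomorphism|].
    unfold nontrivial. auto 8 with regular. }
  unfold rigid. rewrite holds_not. split.
  - intros H R v Hv HR x y Hxy. apply NNPP. intros Hne. apply (H v Hv).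
    rewrite holds_ex by apply reg. intros u Hu.
    exists u. split; [apply wle_refl|]. exists R.
    rewrite holds_and. split.
    + apply holds_isomorphism. eapply iso_at_monotone; eauto.
    + unfold nontrivial. rewrite holds_ex by auto 8 with regular.
      intros u1 Hu1. exists u1. split; [apply wle_refl|]. exists x.
      rewrite holds_ex by auto 8 with regular.
      intros u2 Hu2. exists u2. split; [apply wle_refl|]. exists y.
      rewrite holds_and, holds_ground. split; [|exact Hne].
      eapply mem_monotone; [|exact Hxy]. eauto using wle_trans.
  - intros H v Hv HE. rewrite holds_ex in HE by apply reg.
    destruct (HE v (wle_refl v)) as (u & Hu & R & HR).
    rewrite holds_and in HR. destruct HR as [HR Hn].
    apply holds_isomorphism in HR. unfold nontrivial in Hn.
    rewrite holds_ex in Hn by auto 8 with regular.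
    destruct (Hn u (wle_refl u)) as (u1 & Hu1 & x & Hx).
    rewrite holds_ex in Hx by auto 8 with regular.
    destruct (Hx u1 (wle_refl u1)) as (u2 & Hu2 & y & Hy).
    rewrite holds_and, holds_ground in Hy. destruct Hy as [Hy Hne].
    apply Hne. apply (H R u2); trivial; [eauto using wle_trans|].
    eapply iso_at_monotone; [|eassumption]. eauto using wle_trans.
Qed.

Lemma totally_rigid_rigid (T : tree) (w : world K) :
  holds (totally_rigid M T) w -> holds (rigid M T) w.
Proof.
  rewrite holds_totally_rigid, holds_rigid.
  intros H R v Hv HR x y Hxy. apply NNPP. intros Hne.
  (* The restriction of [R] to arguments above [x], which is regular and so has a name. Its values
     need no separate restriction: comparing with the pair [(x, y)] puts them above [y]. *)
  pose (P := fun (a b : T) (u : world K) =>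
    cone x a /\ holds (is_in (R a b)) u).
  assert (reg : forall a b, regular (wle (m := K)) (P a b)).
  { intros a b. split.
    - intros u u' Hu [Ha Hb]. split; [assumption|]. eapply mem_monotone; eauto.
    - intros u Hd. split.
      + destruct (Hd u (wle_refl u)) as (_ & _ & Ha & _). exact Ha.
      + apply (proj2 (regular_is_in K (R a b))). intros u' Hu'.
        destruct (Hd u' Hu') as (u2 & Hu2 & _ & Hb). eauto. }
  apply (H x y (fun a b => bit_of (P a b)) v Hne Hv).
  assert (Hxy' : forall u, wle v u -> holds (is_in (R x y)) u)
    by (intros; eapply mem_monotone; eauto).
  destruct HR as [H1 H2 H3 H4 H5 H6].
  constructor.
  - intros a b u Hu. rewrite holds_bit_of by apply reg. intros [Ha Hb].
    split; [assumption|]. apply (H6 x y a b u); auto.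
  - intros a Ha u Hu. destruct (H2 a I u Hu) as (u' & Hu' & b & Hb).
    exists u'. split; [assumption|]. exists b.
    rewrite holds_bit_of by apply reg. now split.
  - intros b Hb u Hu. destruct (H3 b I u Hu) as (u' & Hu' & a & Ha).
    exists u'. split; [assumption|]. exists a.
    rewrite holds_bit_of by apply reg. split; [|assumption].
    assert (Hvu : wle v u') by eauto using wle_trans.
    apply (H6 x y a b u'); auto.
  - intros a b b' u Hu. rewrite !holds_bit_of by apply reg.
    intros [_ Hb] [_ Hb']. eauto.
  - intros a a' b u Hu. rewrite !holds_bit_of by apply reg.
    intros [_ Hb] [_ Hb']. eauto.
  - intros a b a' b' u Hu. rewrite !holds_bit_of by apply reg.
    intros [_ Hb] [_ Hb']. eauto.
Qed.

End Forced.

(** The density witnesses of [M] are reused with the tree coordinate left where it is. *)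
Lemma iso_at_check (T0 T : tree) (M : universe) (K : model M) (D E : T -> Prop)
    (R : T -> T -> bit M) (x : world (extension_model T0 K)) :
  iso_at (K := K) D E R (snd x) ->
  iso_at (K := extension_model T0 K) D E (fun a b => check T0 (R a) b) x.
Proof.
  intros [H1 H2 H3 H4 H5 H6]. constructor.
  - intros a b y [_ Hy]. rewrite holds_check. eauto.
  - intros a Ha y [_ Hy]. destruct (H2 a Ha _ Hy) as (u & Hu & b & Hb).
    exists (fst y, u). split; [split; [apply tle_refl | exact Hu]|].
    exists b. now rewrite holds_check.
  - intros b Hb y [_ Hy]. destruct (H3 b Hb _ Hy) as (u & Hu & a & Ha).
    exists (fst y, u). split; [split; [apply tle_refl | exact Hu]|].
    exists a. now rewrite holds_check.
  - intros a b b' y [_ Hy]. rewrite !holds_check. eauto.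
  - intros a a' b y [_ Hy]. rewrite !holds_check. eauto.
  - intros a b a' b' y [_ Hy]. rewrite !holds_check. eauto.
Qed.

Lemma forced_totally_rigid_descends (T0 T : tree) (M : universe) (K : model M)
    (w : world K) :
  holds (m := K) (forced (T := T0) (totally_rigid (extension T0 M) T)) w ->
  holds (m := K) (totally_rigid M T) w.
Proof.
  intros H.
  (* Being forced means being true at the root, so over [w] it is truth at [(root, w)] in the
     extension. *)
  change (holds (m := extension_model T0 K) (totally_rigid (extension T0 M) T)
    (root, w)) in H.
  rewrite holds_totally_rigid in *. intros p q R v Hpq Hv HR.
  apply (H p q (fun a b => check T0 (R a) b) (root, v) Hpq).
  - split; [apply tle_refl | exact Hv].
  - now apply iso_at_check.
Qed.

Lemma forced_rigid_descends (T0 T : tree) (M : universe) (K : model M)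
    (w : world K) :
  holds (m := K) (forced (T := T0) (rigid (extension T0 M) T)) w ->
  holds (m := K) (rigid M T) w.
Proof.
  intros H.
  change (holds (m := extension_model T0 K) (rigid (extension T0 M) T)
    (root, w)) in H.
  rewrite holds_rigid in *. intros R v Hv HR x y Hxy.
  apply (H (fun a b => check T0 (R a) b) (root, v)).
  - split; [apply tle_refl | exact Hv].
  - now apply iso_at_check.
  - now rewrite holds_check.
Qed.

(** * Normal trees *)

Section Trees.

Context (T : tree).

Lemma tle_linear (s t u : T) : tle s u -> tle t u -> tle s t \/ tle t s.
Proof.
  intros Hs Ht.
  destruct (classic (s = u)) as [->|Hsu]; [now right|].
  destruct (classic (t = u)) as [->|Htu]; [now left|].
  destruct (@predecessors_wo T u (fun x => x = s \/ x = t)) as (m & Hm & Hle).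
  - intros x [->| ->]; now split.
  - exists s. now left.
  - destruct Hm as [->| ->]; auto.
Qed.

(** The least proper predecessor of [t], or [t] itself if there is none, is minimal and hence the
    root. *)
Lemma root_least (t : T) : tle root t.
Proof.
  destruct (classic (exists s, tlt s t)) as [He|Hne].
  - destruct (@predecessors_wo T t (fun s => tlt s t)) as (m & [Hm Hne] & Hle);
      auto.
    enough (m = root) by congruence.
    apply root_unique. intros x Hx. apply tle_antisym; [assumption|].
    apply Hle. split; [eapply tle_trans; eauto|].
    intros ->. apply Hne. now apply tle_antisym.
  - enough (t = root) as -> by apply tle_refl.
    apply root_unique. intros x Hx. apply NNPP. intros Hxt. apply Hne.
    exists x. now split.
Qed.

End Trees.

Section Levels.

Context (alpha : ordinal).

Lemma ole_total (b c : alpha) : ole b c \/ ole c b.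
Proof.
  destruct (@ole_wo alpha (fun x => x = b \/ x = c)) as (m & Hm & Hle); auto.
  - exists b. now left.
  - destruct Hm as [->| ->]; auto.
Qed.

Lemma ole_antisym (b c : alpha) : ole b c -> ole c b -> b = c.
Proof. apply (ole_order alpha). Qed.

Lemma ole_trans (b c d : alpha) : ole b c -> ole c d -> ole b d.
Proof. apply (ole_order alpha). Qed.

Lemma ole_refl (b : alpha) : ole b b.
Proof. apply (ole_order alpha). Qed.

Lemma olt_not_ole (b c : alpha) : olt b c -> ~ ole c b.
Proof. intros [H Hne] H'. apply Hne. now apply ole_antisym. Qed.

Lemma ole_cases (b c : alpha) : ole c b \/ olt b c.
Proof.
  destruct (classic (b = c)) as [->|Hne]; [left; apply ole_refl|].
  destruct (ole_total b c) as [H|H]; [right; now split | now left].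
Qed.

Lemma ordinal_ind (P : alpha -> Prop) :
  (forall b, (forall c, olt c b -> P c) -> P b) -> forall b, P b.
Proof.
  intros IH b. apply NNPP. intros Hb.
  destruct (@ole_wo alpha (fun c => ~ P c)) as (m & Hm & Hle); eauto.
  apply Hm, IH. intros c Hc. apply NNPP. intros Hnc.
  apply (olt_not_ole Hc). auto.
Qed.

Context (T : alpha_tree alpha).

Lemma level_ole (s t : T) : tle s t -> ole (level s) (level t).
Proof.
  intros Hst. destruct (classic (s = t)) as [->|Hne]; [apply ole_refl|].
  apply (level_lt (conj Hst Hne)).
Qed.

Lemma tle_level_eq (s t : T) : tle s t -> level s = level t -> s = t.
Proof.
  intros Hst Hl. apply NNPP. intros Hne.
  now apply (level_lt (conj Hst Hne)).
Qed.

Lemma tle_of_level (s t u : T) :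
  tle s u -> tle t u -> ole (level s) (level t) -> tle s t.
Proof.
  intros Hs Ht Hl. destruct (tle_linear Hs Ht) as [H|H]; [assumption|].
  assert (t = s) as ->; [|apply tle_refl].
  apply tle_level_eq; [assumption|]. apply ole_antisym; [|assumption].
  now apply level_ole.
Qed.

Lemma level_below (t : T) (b : alpha) :
  ole b (level t) -> exists s, tle s t /\ level s = b.
Proof.
  intros Hb. destruct (classic (b = level t)) as [->|Hne].
  - exists t. split; [apply tle_refl | reflexivity].
  - destruct (level_onto (conj Hb Hne)) as (s & [Hs _] & Hl). eauto.
Qed.

Context (T_normal : normal T).

Lemma level_above (t : T) (b : alpha) :
  exists s, tle t s /\ ole b (level s).
Proof.
  destruct (ole_cases (level t) b) as [H|H].
  - exists t. split; [apply tle_refl | assumption].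
  - destruct (normal_extension T_normal H) as (s & [Hs _] & <-).
    exists s. split; [assumption | apply ole_refl].
Qed.

Context (no_top : forall b : alpha, ~ is_top b).

Lemma incomparable_successors (t : T) :
  exists s1 s2, tle t s1 /\ tle t s2 /\ ~ tle s1 s2 /\ ~ tle s2 s1.
Proof.
  destruct (normal_splitting T_normal (no_top (b := level t)))
    as (s1 & s2 & Hne & ((H1 & H1') & N1) & ((H2 & H2') & N2)).
  exists s1, s2. repeat split; trivial; intros H; [apply N2 | apply N1].
  - exists s1. repeat split; auto.
  - exists s2. repeat split; auto.
Qed.

(** If [p] is not below [q], the two are incomparable and [p] itself serves. Otherwise [q] lies
    strictly above [p], and at most one immediate successor of [p] is below [q]. Another one,
    compatible with [q], would have [q] strictly between [p] and itself. *)
Lemma incompatible_above (p q : T) :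
  ~ tle q p -> exists s, tle p s /\ ~ exists r, tle s r /\ tle q r.
Proof.
  intros Hqp.
  destruct (classic (tle p q)) as [Hpq|Hpq].
  - destruct (normal_splitting T_normal (no_top (b := level p)))
      as (s1 & s2 & Hne & I1 & I2).
    assert (key : forall s, immediate_successor p s -> ~ tle s q ->
      ~ exists r, tle s r /\ tle q r).
    { intros s ((Hs & Hps) & N) Hsq (r & Hr & Hqr).
      destruct (tle_linear Hr Hqr) as [H|H]; [contradiction|].
      apply N. exists q. repeat split; trivial.
      - intros ->. apply Hqp, tle_refl.
      - intros ->. apply Hsq, tle_refl. }
    destruct (classic (tle s1 q)) as [H1|H1].
    + exists s2. split; [apply I2|]. apply key; [assumption|]. intros H2.
      destruct I1 as ((L1 & L1') & N1), I2 as ((L2 & L2') & N2).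
      destruct (tle_linear H1 H2) as [H|H]; [apply N2 | apply N1].
      * exists s1. repeat split; auto.
      * exists s2. repeat split; auto.
    + exists s1. split; [apply I1 | now apply key].
  - exists p. split; [apply tle_refl|]. intros (r & Hr & Hqr).
    destruct (tle_linear Hr Hqr); contradiction.
Qed.

End Levels.

(** * Branches in generic extensions *)

Section Branches.

Context (alpha : ordinal) (T : alpha_tree alpha).

Record branch_at (M : universe) (K : model M) (B : T -> bit M) (w : world K) :
    Prop := BranchAt {
  branch_chain : forall s t v, wle w v ->
    holds (is_in (B s)) v -> holds (is_in (B t)) v -> tle s t \/ tle t s;
  branch_maximal : forall t v, wle w v ->
    (forall s u, wle v u -> holds (is_in (B s)) u -> tle s t \/ tle t s) ->
    holds (is_in (B t)) v;
  branch_cofinal : forall b,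
    densely wle (fun u => exists t, holds (is_in (B t)) u /\ level t = b) w
}.

Definition same_at (M : universe) (K : model M) (A : Type) (X Y : A -> bit M)
    (w : world K) :=
  forall a v, wle w v -> (holds (is_in (X a)) v <-> holds (is_in (Y a)) v).

Lemma holds_same_set (M : universe) (K : model M) (A : Type) (X Y : A -> bit M)
    (w : world K) :
  holds (same_set X Y) w <-> same_at X Y w.
Proof.
  unfold same_set, fiff, same_at. rewrite holds_all.
  setoid_rewrite holds_and. setoid_rewrite holds_imp.
  split.
  - intros H a v Hv. destruct (H a). split; auto.
  - intros H a. split; intros v Hv; apply (H a v Hv).
Qed.

Lemma regular_same_set (M : universe) (K : model M) (A : Type)
    (X Y : A -> bit M) :
  regular (wle (m := K)) (holds (same_set X Y)).
Proof. unfold same_set, fiff. auto 8 with regular. Qed.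

Lemma holds_cofinal_branch (M : universe) (K : model M) (B : T -> bit M)
    (w : world K) :
  holds (cofinal_branch B) w <-> branch_at B w.
Proof.
  unfold cofinal_branch. rewrite !holds_and. repeat setoid_rewrite holds_all.
  setoid_rewrite holds_mem_imp2. repeat setoid_rewrite holds_imp.
  repeat setoid_rewrite holds_all. setoid_rewrite holds_mem_imp.
  assert (reg : forall (b : alpha) (t : T), regular (wle (m := K))
    (holds (fand (is_in (B t)) (fground (level t = b))))) by auto with regular.
  split.
  - intros (H1 & H2 & H3). constructor; eauto.
    intros b. specialize (H3 b). rewrite holds_ex in H3 by apply reg.
    intros v Hv. destruct (H3 v Hv) as (u & Hu & t & Ht).
    rewrite holds_and, holds_ground in Ht. eauto.
  - intros [H1 H2 H3]. split; [eauto|]. split; [eauto|].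
    intros b. rewrite holds_ex by apply reg. intros v Hv.
    destruct (H3 b v Hv) as (u & Hu & t & Ht).
    exists u. split; [assumption|]. exists t.
    now rewrite holds_and, holds_ground.
Qed.

(** Maximality comes for free: a node comparable with the whole chain is comparable with the member
    on its own level, hence equal to it. *)
Lemma branch_of_chain (M : universe) (K : model M) (B : T -> bit M)
    (w : world K) :
  (forall s t v, wle w v -> holds (is_in (B s)) v -> holds (is_in (B t)) v ->
    tle s t \/ tle t s) ->
  (forall b, densely wle
    (fun u => exists t, holds (is_in (B t)) u /\ level t = b) w) ->
  branch_at B w.
Proof.
  intros Hc Hf. constructor; trivial. intros t v Hv Hcomp.
  apply (proj2 (regular_is_in K (B t))). intros u Hu.
  destruct (Hf (level t) u) as (u' & Hu' & s & Hs & Hl);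
    [eauto using wle_trans|].
  exists u'. split; [assumption|]. enough (s = t) as <- by assumption.
  destruct (Hcomp s u') as [H|H]; eauto using wle_trans.
  - now apply tle_level_eq.
  - symmetry. now apply tle_level_eq.
Qed.

Context (M : universe) (K : model M).

Notation KT := (extension_model T K).

Definition new_at (B : T -> bit (extension T M)) (x : world KT) :=
  branch_at (K := KT) B x /\
  forall (X : T -> bit M) y, wle (m := KT) x y ->
    ~ same_at (K := KT) B (check T X) y.

Lemma holds_new_cofinal_branch (B : T -> bit (extension T M)) (x : world KT) :
  holds (m := KT) (new_cofinal_branch B) x <-> new_at B x.
Proof.
  unfold new_cofinal_branch, new_at.
  rewrite (holds_and (m := KT)), holds_cofinal_branch, (holds_all (m := KT)).
  repeat setoid_rewrite (holds_not (K := KT)).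
  repeat setoid_rewrite (holds_same_set (K := KT)). reflexivity.
Qed.

Lemma regular_new_cofinal_branch (B : T -> bit (extension T M)) :
  regular (wle (m := KT)) (holds (m := KT) (new_cofinal_branch B)).
Proof.
  unfold new_cofinal_branch, cofinal_branch.
  pose proof (regular_same_set KT). auto 12 with regular.
Qed.

Lemma new_at_monotone (B : T -> bit (extension T M)) (x y : world KT) :
  wle (m := KT) x y -> new_at B x -> new_at B y.
Proof.
  rewrite <- !holds_new_cofinal_branch.
  apply monotone, regular_new_cofinal_branch.
Qed.

Definition unique_new_at (B : T -> bit (extension T M)) (x : world KT) :=
  new_at B x /\
  forall C y, wle (m := KT) x y -> new_at C y -> same_at (K := KT) C B y.

(** The name [B] of the unique branch may vary with the condition, as the existential only asks for
    one densely. *)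
Lemma holds_UBP (w : world K) :
  holds (m := K) (UBP M T) w <->
  densely (wle (m := KT)) (fun x => exists B, unique_new_at B x) (root, w).
Proof.
  change (holds (m := K) (UBP M T) w) with
    (holds (m := KT) (@exactly_one_new_cofinal_branch M alpha T) (root, w)).
  unfold exactly_one_new_cofinal_branch, unique_new_at.
  pose proof (regular_same_set KT).
  pose proof regular_new_cofinal_branch.
  rewrite (holds_ex (m := KT)) by auto 8 with regular.
  assert (eq : forall B x, holds (m := KT) (fand (new_cofinal_branch B)
      (fall _ (fun C => fimp (new_cofinal_branch C) (same_set C B)))) x <->
    unique_new_at B x).
  { intros B x. unfold unique_new_at.
    rewrite (holds_and (m := KT)), (holds_all (m := KT)).
    rewrite holds_new_cofinal_branch.
    setoid_rewrite (holds_imp (m := KT)).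
    setoid_rewrite holds_new_cofinal_branch.
    setoid_rewrite (holds_same_set (K := KT)). reflexivity. }
  split; intros HU x Hx; destruct (HU x Hx) as (y & Hy & B & HB);
    exists y; (split; [assumption|]); exists B; now apply eq.
Qed.

(** A top node decides every name, so that forcing with a tree that has a top
    level adds nothing. *)
Lemma new_at_no_top (T_normal : normal T) (B : T -> bit (extension T M))
    (x : world KT) :
  new_at B x -> forall b : alpha, ~ is_top b.
Proof.
  intros HB b Hb.
  destruct (level_above T_normal (fst x) b) as (s & Hs & Hl).
  assert (Hmax : forall r, tle s r -> r = s).
  { intros r Hr. symmetry. apply tle_level_eq; [assumption|].
    apply ole_antisym; [now apply level_ole|].
    apply ole_trans with b; [apply Hb | assumption]. }
  (* What the top node [s] forces into [B] is a set of the ground model. *)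
  pose (P := fun (t : T) (v : world K) =>
    holds (m := KT) (is_in (B t)) (s, v)).
  assert (reg : forall t, regular (wle (m := K)) (P t))
    by (intros t; exact (regular_section s (regular_is_in KT (B t)))).
  apply (proj2 HB (fun t => bit_of (P t)) (s, snd x)).
  - split; [exact Hs | apply wle_refl].
  - intros t [r v] [Hr _]. simpl in Hr. apply Hmax in Hr as ->.
    rewrite holds_check, holds_bit_of by apply reg. reflexivity.
Qed.

(** Induction on the common level of [x] and [x']. If [y'] were higher than [y], let [z] be the
    predecessor of [y'] on the level of [y], [x0] its preimage below [x'], [x1] the predecessor of
    [x] on the level of [x0], and [y1] its image. Then [y1] is strictly below [y], while the
    induction hypothesis puts it at least as high as [z]. *)
Lemma iso_level (p q : T) (R : T -> T -> bit M) (w : world K) :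
  iso_at (cone p) (cone q) R w ->
  forall x x' y y' v, wle w v -> level x = level x' ->
    holds (is_in (R x y)) v -> holds (is_in (R x' y')) v ->
    level y = level y'.
Proof.
  intros HR.
  enough (key : forall b x x' y y' v, wle w v -> level x = b -> level x' = b ->
    holds (is_in (R x y)) v -> holds (is_in (R x' y')) v ->
    ole (level y') (level y)) by (intros; apply ole_antisym; eauto).
  intros b. induction b as [b IH] using ordinal_ind.
  intros x x' y y' v Hv Hx Hx' Hxy Hxy'.
  destruct (ole_cases (level y) (level y')) as [H|Hlt]; [assumption|exfalso].
  destruct (level_onto Hlt) as (z & [Hzy' Hne] & Hz).
  destruct (iso_dom HR Hv Hxy) as [Dx Ey].
  destruct (iso_dom HR Hv Hxy') as [Dx' Ey'].
  unfold cone in *.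
  assert (Ez : tle q z).
  { apply tle_of_level with y'; trivial. rewrite Hz. now apply level_ole. }
  destruct (iso_onto HR Ez Hv) as (u & Hu & x0 & Hx0).
  assert (Hwu : wle w u) by eauto using wle_trans.
  assert (Hxy'u : holds (is_in (R x' y')) u) by eauto using mem_monotone.
  assert (L0 : tlt x0 x').
  { split; [now apply (iso_mono HR Hwu Hx0 Hxy'u)|]. intros ->.
    apply Hne, (iso_fun HR Hwu Hx0 Hxy'u). }
  pose proof (level_lt L0) as Hl0. rewrite Hx' in Hl0.
  destruct (@level_onto _ T x (level x0)) as (x1 & [Hx1 Hne1] & Hl1);
    [now rewrite Hx|].
  destruct (iso_dom HR Hwu Hx0) as [Dx0 _].
  assert (Dx1 : tle p x1).
  { apply tle_of_level with x; trivial. rewrite Hl1. now apply level_ole. }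
  destruct (iso_total HR Dx1 Hwu) as (u' & Hu' & y1 & Hy1).
  assert (Hwu' : wle w u') by eauto using wle_trans.
  assert (Hxyu' : holds (is_in (R x y)) u') by eauto using mem_monotone, wle_trans.
  assert (L1 : tlt y1 y).
  { split; [now apply (iso_mono HR Hwu' Hy1 Hxyu')|]. intros ->.
    apply Hne1, (iso_inj HR Hwu' Hy1 Hxyu'). }
  apply (olt_not_ole (level_lt L1)). rewrite <- Hz.
  apply (IH (level x0) Hl0 x1 x0 y1 z u'); eauto using mem_monotone.
Qed.

(** The downward closure of the image under [R] of the generic branch. *)
Definition image_branch (R : T -> T -> bit M) (t : T) : bit (extension T M) :=
  bit_of (m := KT) (densely (wle (m := KT)) (fun x =>
    exists y z, tle y (fst x) /\ tle t z /\
      holds (m := K) (is_in (R y z)) (snd x))).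

Lemma holds_image_branch (R : T -> T -> bit M) (t : T) (x : world KT) :
  holds (m := KT) (is_in (image_branch R t)) x <->
  densely (wle (m := KT)) (fun x => exists y z, tle y (fst x) /\ tle t z /\
    holds (m := K) (is_in (R y z)) (snd x)) x.
Proof.
  unfold image_branch. apply holds_bit_of, densely_regular.
  - apply wle_refl.
  - apply wle_trans.
Qed.

Lemma image_branch_intro (R : T -> T -> bit M) (t y z : T) (x : world KT) :
  tle y (fst x) -> tle t z -> holds (m := K) (is_in (R y z)) (snd x) ->
  holds (m := KT) (is_in (image_branch R t)) x.
Proof.
  intros Hy Hz HR. rewrite holds_image_branch. intros x' [Hx' Hx''].
  exists x'. split; [apply ext_le_refl|]. exists y, z.
  split; [eapply tle_trans; eauto|]. split; [assumption|].
  eapply mem_monotone; eauto.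
Qed.

(** * The image of the generic branch is a new cofinal branch *)

Section Image.

Context (T_normal : normal T) (no_top : forall b : alpha, ~ is_top b).
Context (p q s : T) (R : T -> T -> bit M) (v : world K).
Context (HR : iso_at (cone p) (cone q) R v) (Hps : tle p s).

(** After two extensions, both arguments [y] and [y'] lie below one tree condition. They are
    therefore comparable, and so are their images. *)
Lemma image_chain (a b : T) (x : world KT) :
  wle (m := KT) (s, v) x ->
  holds (m := KT) (is_in (image_branch R a)) x ->
  holds (m := KT) (is_in (image_branch R b)) x ->
  tle a b \/ tle b a.
Proof.
  intros Hx Ha Hb. rewrite holds_image_branch in Ha, Hb.
  destruct (Ha x (ext_le_refl x)) as (x1 & H1 & y & z & Hy & Haz & Hyz).
  destruct (Hb x1 H1) as (x2 & H2 & y' & z' & Hy' & Hbz & Hyz').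
  assert (Hv : wle v (snd x2)) by
    (eapply wle_trans; [apply Hx|]; eapply wle_trans; [apply H1 | apply H2]).
  assert (Hyz2 : holds (m := K) (is_in (R y z)) (snd x2))
    by (eapply mem_monotone; [apply H2 | assumption]).
  assert (Hy2 : tle y (fst x2)) by (eapply tle_trans; [exact Hy | apply H2]).
  destruct (tle_linear Hy2 Hy') as [H|H].
  - apply (iso_mono HR Hv Hyz2 Hyz') in H.
    apply tle_linear with z'; [eapply tle_trans|]; eauto.
  - apply (iso_mono HR Hv Hyz' Hyz2) in H.
    apply tle_linear with z; [|eapply tle_trans]; eauto.
Qed.

(** The level needed in the domain is found by pulling back: [x0] is a preimage of a node [z] of
    level at least [b]. Any predecessor [x] of the tree condition on the level of [x0] then has an
    image on the level of [z], by [iso_level]. *)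
Lemma image_cofinal (b : alpha) :
  densely (wle (m := KT)) (fun x => exists t,
    holds (m := KT) (is_in (image_branch R t)) x /\ level t = b) (s, v).
Proof.
  intros [r u] [Hr Hu]. simpl in Hr, Hu.
  destruct (level_above T_normal q b) as (z & Hz & Hbz).
  destruct (iso_onto HR Hz Hu) as (u1 & Hu1 & x0 & Hx0).
  assert (Hv1 : wle v u1) by eauto using wle_trans.
  destruct (level_above T_normal r (level x0)) as (r' & Hr' & Hl).
  destruct (level_below Hl) as (x & Hx & Hlx).
  assert (Dx : cone p x).
  { apply tle_of_level with r'; trivial.
    - eauto using tle_trans.
    - rewrite Hlx. apply level_ole. apply (iso_dom HR Hv1 Hx0). }
  destruct (iso_total HR Dx Hv1) as (u2 & Hu2 & y & Hy).
  assert (Hv2 : wle v u2) by eauto using wle_trans.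
  assert (Hly : level y = level z)
    by (apply (iso_level HR Hv2 Hlx Hy); eauto using mem_monotone).
  rewrite <- Hly in Hbz. destruct (level_below Hbz) as (t & Ht & Hlt).
  exists (r', u2). split.
  - split; simpl; eauto using wle_trans.
  - exists t. split; [|assumption]. now apply image_branch_intro with x y.
Qed.

(** Two incomparable conditions force incomparable nodes into the branch; a
    set of the ground model equal to it would contain both. *)
Lemma image_new : new_at (image_branch R) (s, v).
Proof.
  split; [apply branch_of_chain; [apply image_chain | apply image_cofinal]|].
  intros X [r u] [Hr Hu] HX. simpl in Hr, Hu.
  destruct (incomparable_successors T_normal no_top r)
    as (s1 & s2 & H1 & H2 & N1 & N2).
  assert (D1 : cone p s1) by (unfold cone; eauto using tle_trans).
  assert (D2 : cone p s2) by (unfold cone; eauto using tle_trans).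
  destruct (iso_total HR D1 Hu) as (u1 & Hu1 & y1 & Hy1).
  assert (Hv1 : wle v u1) by eauto using wle_trans.
  destruct (iso_total HR D2 Hv1) as (u2 & Hu2 & y2 & Hy2).
  assert (Hv2 : wle v u2) by eauto using wle_trans.
  assert (Hy1' : holds (is_in (R s1 y1)) u2) by eauto using mem_monotone.
  assert (E1 : wle (m := KT) (r, u) (s1, u2))
    by (split; simpl; eauto using wle_trans).
  assert (E2 : wle (m := KT) (r, u) (s2, u2))
    by (split; simpl; eauto using wle_trans).
  assert (B1 : holds (m := KT) (is_in (image_branch R y1)) (s1, u2))
    by (apply image_branch_intro with s1 y1; trivial; apply tle_refl).
  (* [s2] puts [y2] into the image, hence into [X]; since [X] ignores the tree coordinate, [s1] must
     put it there too. *)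
  assert (B2 : holds (m := KT) (is_in (image_branch R y2)) (s1, u2)).
  { apply (HX y2 _ E1). rewrite holds_check.
    apply (holds_check X y2 (K := K) (s2, u2)), (HX y2 _ E2).
    apply image_branch_intro with s2 y2; trivial; apply tle_refl. }
  destruct (image_chain (x := (s1, u2)) (a := y1) (b := y2)) as [H|H]; trivial.
  - split; simpl; eauto using tle_trans.
  - apply N1, (iso_mono HR Hv2 Hy1' Hy2), H.
  - apply N2, (iso_mono HR Hv2 Hy2 Hy1'), H.
Qed.

End Image.

(** Below [p], the image of the generic branch under this isomorphism is the generic branch itself,
    so the results on images apply to it. *)
Definition cone_identity (p x y : T) : bit M :=
  bit_of (m := K) (fun _ => cone p x /\ x = y).

Lemma holds_cone_identity (p x y : T) (w : world K) :
  holds (is_in (cone_identity p x y)) w <-> cone p x /\ x = y.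
Proof.
  apply (holds_bit_of (P := fun _ => cone p x /\ x = y)). split; [auto|].
  intros v H. destruct (H v (wle_refl v)) as (_ & _ & Hx). exact Hx.
Qed.

Lemma iso_at_cone_identity (p : T) (w : world K) :
  iso_at (cone p) (cone p) (cone_identity p) w.
Proof.
  constructor.
  - intros x y v _. rewrite holds_cone_identity. intros [Hx <-]. now split.
  - intros x Hx v Hv. exists v. split; [apply wle_refl|].
    exists x. now rewrite holds_cone_identity.
  - intros x Hx v Hv. exists v. split; [apply wle_refl|].
    exists x. now rewrite holds_cone_identity.
  - intros x y y' v _. rewrite !holds_cone_identity. intuition congruence.
  - intros x x' y v _. rewrite !holds_cone_identity. intuition congruence.
  - intros x y x' y' v _. rewrite !holds_cone_identity.
    intros [_ <-] [_ <-]. reflexivity.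
Qed.

(** If [q] were not below [p], some condition above [p] would be incompatible
    with [q]; but that condition forces that the image of the generic branch under [R] passes
    through [q] and, by uniqueness, is the generic branch. *)
Lemma UBP_iso_tle (T_normal : normal T) (w v : world K) (p q : T)
    (R : T -> T -> bit M) :
  holds (m := K) (UBP M T) w -> wle w v -> iso_at (cone p) (cone q) R v ->
  tle q p.
Proof.
  rewrite holds_UBP. intros HU Hv HR.
  assert (no_top : forall b : alpha, ~ is_top b).
  { destruct (HU _ (ext_le_refl _)) as (x & _ & B & HB & _).
    exact (new_at_no_top T_normal HB). }
  apply NNPP. intros Hqp.
  destruct (incompatible_above T_normal no_top Hqp) as (s & Hs & Hincomp).
  destruct (HU (s, v)) as ([r u] & [Hr Hu] & B & _ & HB).
  { split; [apply root_least | assumption]. }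
  simpl in Hr, Hu.
  assert (Hpr : tle p r) by eauto using tle_trans.
  pose proof (iso_at_monotone Hu HR) as HRu.
  (* Uniqueness is applied twice, to the image under [R] and to the generic branch: both equal
     [B]. *)
  pose proof (HB _ (r, u) (ext_le_refl _)
    (image_new T_normal no_top HRu Hpr)) as E1.
  pose proof (HB _ (r, u) (ext_le_refl _)
    (image_new T_normal no_top (iso_at_cone_identity p u) Hpr)) as E2.
  assert (Hq : holds (m := KT) (is_in (image_branch R q)) (r, u)).
  { rewrite holds_image_branch. intros [r' u'] [Hr' Hu']. simpl in Hr', Hu'.
    destruct (iso_total HRu (tle_refl p) Hu') as (u2 & Hu2 & z & Hz).
    exists (r', u2). split; [split; [apply tle_refl | exact Hu2]|].
    exists p, z. split; [simpl; eauto using tle_trans|]. split; [|assumption].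
    apply (iso_dom HRu (wle_trans Hu' Hu2) Hz). }
  apply (E1 q _ (ext_le_refl _)), (E2 q _ (ext_le_refl _)) in Hq.
  rewrite holds_image_branch in Hq.
  destruct (Hq _ (ext_le_refl _)) as ([r' u'] & [Hr' _] & y & z & Hy & Hz & He).
  rewrite holds_cone_identity in He. destruct He as [_ <-]. simpl in *.
  apply Hincomp. exists r'. split; eauto using tle_trans.
Qed.

Lemma UBP_totally_rigid (T_normal : normal T) (w : world K) :
  holds (m := K) (UBP M T) w -> holds (m := K) (totally_rigid M T) w.
Proof.
  intros HU. rewrite holds_totally_rigid. intros p q R v Hpq Hv HR.
  apply Hpq, tle_antisym.
  - exact (UBP_iso_tle T_normal HU Hv (iso_at_inverse HR)).
  - exact (UBP_iso_tle T_normal HU Hv HR).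
Qed.

End Branches.

(** * Forcing twice *)

Section Product.

Context (alpha : ordinal) (T : alpha_tree alpha) (M : universe) (K : model M).

Notation KT := (extension_model T K).
Notation KTT := (extension_model T KT).

(** A condition of the outer extension is a pair [(s, (r, w))]: [r] belongs to the
    first generic branch and [s] to the second one.  [lift C] evaluates the
    name [C] with the second one. *)
Definition lift (C : T -> bit (extension T M)) (t : T) :
    bit (extension T (extension T M)) :=
  bit_of (m := KTT) (fun x => holds (m := KT) (is_in (C t)) (fst x, snd (snd x))).

Lemma holds_lift (C : T -> bit (extension T M)) (t : T) (x : world KTT) :
  holds (m := KTT) (is_in (lift C t)) x <->
  holds (m := KT) (is_in (C t)) (fst x, snd (snd x)).
Proof.
  unfold lift. refine (holds_bit_of (m := KTT) _ _).
  destruct (regular_is_in KT (C t)) as [m d]. split.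
  - intros y z (H1 & H2 & H3). apply m. now split.
  - intros y H. apply d. intros [q v] [Hq Hv].
    destruct (H (q, (fst (snd y), v))) as (z & (H1 & _ & H3) & Hz).
    + split; [exact Hq|]. split; [apply tle_refl | exact Hv].
    + exists (fst z, snd (snd z)). split; [now split | exact Hz].
Qed.

(** Density witnesses for [C] carry over with the condition on the first branch left unchanged. *)
Lemma branch_at_lift (C : T -> bit (extension T M)) (x : world KTT) :
  branch_at (K := KT) C (fst x, snd (snd x)) ->
  branch_at (K := KTT) (lift C) x.
Proof.
  intros [Hc _ Hf]. apply branch_of_chain.
  - intros s t y (H1 & _ & H3). rewrite !holds_lift. apply Hc. now split.
  - intros b y (H1 & _ & H3).
    destruct (Hf b (fst y, snd (snd y))) as ([q v] & [Hq Hv] & t & Ht & Hl);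
      [now split|].
    exists (q, (fst (snd y), v)). split.
    + split; [exact Hq|]. split; [apply tle_refl | exact Hv].
    + exists t. split; [now rewrite holds_lift | assumption].
Qed.

(** If the second generic evaluates [C] to a set [X] added by the first one,
    then [s] decides [C]: what a condition above [s] forces into [C] is in [X]
    regardless of the second generic, hence is already forced by [s]. *)
Lemma new_at_lift (C : T -> bit (extension T M)) (x : world KTT) :
  new_at (K := K) C (fst x, snd (snd x)) -> new_at (K := KT) (lift C) x.
Proof.
  intros [HC Hnew]. split; [now apply branch_at_lift|].
  intros X [s (r & w)] (Hs & _ & Hw) HX. simpl in Hs, Hw.
  pose (P := fun (t : T) (v : world K) => holds (m := KT) (is_in (C t)) (s, v)).
  assert (reg : forall t, regular (wle (m := K)) (P t))
    by (intros t; exact (regular_section s (regular_is_in KT (C t)))).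
  apply (Hnew (fun t => bit_of (P t)) (s, w)); [now split|].
  intros t [s' w'] [Hs' Hw']. simpl in Hs', Hw'.
  rewrite holds_check, holds_bit_of by apply reg. unfold P. simpl snd.
  split; intros H.
  - assert (E : wle (m := KTT) (s, (r, w)) (s', (r, w')))
      by (split; [exact Hs'|]; split; [apply tle_refl | exact Hw']).
    assert (E0 : wle (m := KTT) (s, (r, w)) (s, (r, w')))
      by (split; [apply tle_refl|]; split; [apply tle_refl | exact Hw']).
    apply (holds_lift C t (s, (r, w'))), (HX t _ E0), holds_check.
    apply (holds_check (K := KT) X t (s', (r, w'))), (HX t _ E).
    now apply holds_lift.
  - eapply (mem_monotone (K := KT)); [|exact H].
    split; [exact Hs' | apply wle_refl].
Qed.

(** The generic branch [G] is the witness. For a rival [C], both [lift C] and [lift G] are new over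
    the first extension, so both equal the branch [B] given by the outer hypothesis. As lifts read
    only the outer and ground coordinates, their agreement is agreement of [C] and [G]. *)
Lemma forced_UBP_descends (T_normal : normal T) (w : world K) :
  holds (m := K) (forced (T := T) (UBP (extension T M) T)) w ->
  holds (m := K) (UBP M T) w.
Proof.
  intros HU.
  change (holds (m := KT) (UBP (extension T M) T) (root, w)) in HU.
  rewrite holds_UBP in HU.
  assert (no_top : forall b : alpha, ~ is_top b).
  { destruct (HU _ (ext_le_refl _)) as (x & _ & B & HB & _).
    exact (new_at_no_top T_normal HB). }
  rewrite holds_UBP. intros [p v] [_ Hv]. simpl in Hv.
  pose (G := image_branch K (cone_identity K (root : T))).
  assert (HG : new_at (K := K) G (p, v))
    by exact (image_new T_normal no_top (iso_at_cone_identity root v)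
      (root_least p)).
  exists (p, v). split; [apply ext_le_refl|]. exists G. split; [exact HG|].
  intros C y Hy HC. apply holds_same_set.
  (* Agreement is regular, so it suffices to obtain it densely, where the outer hypothesis supplies
     its [B]. *)
  apply (proj2 (regular_same_set KT C G)). intros [s u] Hsu.
  assert (Hvu : wle v u) by
    (eapply wle_trans; [apply Hy | apply Hsu]).
  destruct (HU (s, (root, u))) as ([s' (r' & u')] & (Hs & _ & Hu) & B & _ & HB).
  { split; [apply root_least|]. split; [apply tle_refl|].
    eapply wle_trans; eauto. }
  simpl in Hs, Hu.
  assert (Hsu' : wle (m := KT) (s, u) (s', u')) by now split.
  exists (s', u'). split; [exact Hsu'|]. apply holds_same_set.
  assert (EC := HB (lift C) (s', (r', u')) (ext_le_refl _)).
  assert (EG := HB (lift G) (s', (r', u')) (ext_le_refl _)).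
  assert (NC : new_at (K := K) C (s', u'))
    by (eapply new_at_monotone; [|exact HC]; eapply (wle_trans (m := KT)); eauto).
  assert (NG : new_at (K := K) G (s', u'))
    by (eapply new_at_monotone; [|exact HG];
        eapply (wle_trans (m := KT)); [|exact Hsu'];
        eapply (wle_trans (m := KT)); eauto).
  specialize (EC (new_at_lift (x := (s', (r', u'))) NC)).
  specialize (EG (new_at_lift (x := (s', (r', u'))) NG)).
  intros t [s2 u2] [H2 H3]. simpl in H2, H3.
  assert (E : wle (m := KTT) (s', (r', u')) (s2, (r', u2)))
    by (split; [exact H2|]; split; [apply tle_refl | exact H3]).
  specialize (EC t _ E). specialize (EG t _ E). rewrite holds_lift in EC, EG.
  exact (iff_trans EC (iff_sym EG)).
Qed.

End Product.

Theorem theorem1p2 (alpha : ordinal) (T : alpha_tree alpha)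
    (alpha_le : le_omega1 alpha) (T_normal : normal T) :
  (absolutely_rigid T \/ totally_rigid V T -> rigid V T) /\
  (absolutely_totally_rigid T -> totally_rigid V T /\ absolutely_rigid T) /\
  (UBP V T -> totally_rigid V T) /\
  (absolutely_UBP T -> UBP V T /\ absolutely_totally_rigid T).
Proof.
  pose (K := V_model). pose (KT := extension_model T K).
  refine (conj _ (conj _ (conj _ _))).
  - intros [H|H].
    + exact (forced_rigid_descends (K := K) (w := tt) H).
    + exact (totally_rigid_rigid (K := K) (w := tt) H).
  - intros H. split.
    + exact (forced_totally_rigid_descends (K := K) (w := tt) H).
    (* The general lemma is read in the extension; truth at [(root, tt)] there unfolds to being
       forced over [V]. *)
    + exact (totally_rigid_rigid (K := KT) (w := (root, tt)) H).
  - intros H. exact (UBP_totally_rigid (K := K) T_normal (w := tt) H).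
  - intros H. split.
    + exact (forced_UBP_descends (K := K) T_normal (w := tt) H).
    + exact (UBP_totally_rigid (K := KT) T_normal (w := (root, tt)) H).
Qed.
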